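(* Let $\alpha,\beta,c$ be real numbers and consider on the space of polynomials in $x$ the operators $$X=L_0+\alpha+\beta+1,\qquad Y=x\ (\text{multiplication by }x),\qquad Z=-\frac2x\bigl(c+(x-1)(x+c)R\bigr),$$ where $Rf(x)=f(-x)$ and $$L_0f(x)=\frac{(\alpha+\beta+1)x^2+(c\alpha-\beta)x+c}{x^2}\bigl(f(-x)-f(x)\bigr)-\frac{2(x-1)(x+c)}{x}f'(-x).$$ Then $$XY+YX=Z+\omega_3,\qquad YZ+ZY=\omega_1,\qquad ZX+XZ=4Y+\omega_2,$$ with $$\omega_1=-4c,\qquad\omega_2=4(\alpha-\beta c),\qquad\omega_3=2(\beta-\alpha c).$$ That is, $X,Y,Z$ realize the Askey–Wilson algebra with $q=-1$, $\mu_1=0$, $\mu_2=4$, $\mu_3=1$. The element $Q=Z^2+4Y^2$ commutes with $X,Y,Z$ in the algebra defined by these relations, and in the realization by the operators $X=L_0+\alpha+\beta+1$, $Y=x$, $Z=-\frac2x\bigl(c+(x-1)(x+c)R\bigr)$ on polynomials, $Q$ equals the constant $4(c^2+1)$.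
   Context: The Askey–Wilson algebra $AW(3)$ with parameters $q,\mu_i,\omega_i$ is the algebra generated by $X,Y,Z$ with relations $XY-qYX=\mu_3Z+\omega_3$, $YZ-qZY=\mu_1X+\omega_1$, $ZX-qXZ=\mu_2Y+\omega_2$. Scalars denote the corresponding multiples of the identity operator. *)

(* Defs.v *)
From HB Require Import structures.
From mathcomp Require Import all_boot all_order all_algebra generic_quotient.
From mathcomp Require Import boolp reals ring lra.
From mathcomp.multinomials Require Import monalg.

Set Implicit Arguments.
Unset Strict Implicit.
Unset Printing Implicit Defensive.
Import Order.TTheory GRing.Theory Num.Theory.
Local Open Scope ring_scope.
Local Open Scope quotient_scope.

Inductive ideal_gen (A : pzRingType) (S : A -> Prop) : A -> Prop :=
| ideal_in x : S x -> ideal_gen S x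
| ideal_0 : ideal_gen S 0
| ideal_D x y : ideal_gen S x -> ideal_gen S y -> ideal_gen S (x + y)
| ideal_Ml a x : ideal_gen S x -> ideal_gen S (a * x)
| ideal_Mr a x : ideal_gen S x -> ideal_gen S (x * a).

Section QuotientAlgebra.
Variables (K : comNzRingType) (A : lalgType K) (S : A -> Prop).

Definition ideal_rel : rel A := fun x y => `[< ideal_gen S (x - y) >].

Lemma ideal_gen_opp x : ideal_gen S x -> ideal_gen S (- x).
Proof. by rewrite -mulN1r; exact: ideal_Ml. Qed.

Fact ideal_rel_is_equiv : equiv_class_of ideal_rel.
Proof.
have sym x y : ideal_rel x y -> ideal_rel y x.
  by move=> /asboolP/ideal_gen_opp xy; apply/asboolP; rewrite -opprB.
split=> [x|x y|y x z].
- by apply/asboolP; rewrite subrr; exact: ideal_0.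
- by apply/idP/idP; exact: sym.
- move=> /asboolP xy /asboolP yz; apply/asboolP.
  by rewrite -(subrKA y); exact: ideal_D.
Qed.

Canonical ideal_rel_equiv := EquivRelPack ideal_rel_is_equiv.

Definition quot_alg := {eq_quot ideal_rel}.
HB.instance Definition _ := Choice.on quot_alg.
HB.instance Definition _ := EqQuotient.on quot_alg.

Definition quot_pi (x : A) : quot_alg := \pi_quot_alg x.

Lemma quot_piP (x y : A) : quot_pi x = quot_pi y <-> ideal_gen S (x - y).
Proof.
rewrite (rwP eqP) (eqquotE quot_alg).
by split=> [/asboolP|xy]; last apply/asboolP.
Qed.

Lemma quot_piW (P : quot_alg -> Prop) :
  (forall x, P (quot_pi x)) -> forall y, P y.
Proof. by move=> Ppi y; rewrite -[y]reprK; exact: Ppi. Qed.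

Lemma reprB_ideal x : ideal_gen S (repr (quot_pi x) - x).
Proof. by apply/quot_piP; rewrite /quot_pi reprK. Qed.

Definition quot_zero := quot_pi 0.
Definition quot_one := quot_pi 1.
Definition quot_opp (x : quot_alg) := quot_pi (- repr x).
Definition quot_add (x y : quot_alg) := quot_pi (repr x + repr y).
Definition quot_mul (x y : quot_alg) := quot_pi (repr x * repr y).
Definition quot_scale (k : K) (x : quot_alg) := quot_pi (k *: repr x).

Lemma quot_oppE x : quot_opp (quot_pi x) = quot_pi (- x).
Proof.
apply/quot_piP; rewrite -opprD; apply: ideal_gen_opp.
exact: reprB_ideal.
Qed.

Lemma quot_addE x y : quot_add (quot_pi x) (quot_pi y) = quot_pi (x + y).
Proof.
apply/quot_piP; rewrite opprD addrACA.
by apply: ideal_D; exact: reprB_ideal.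
Qed.

Lemma quot_mulE x y : quot_mul (quot_pi x) (quot_pi y) = quot_pi (x * y).
Proof.
apply/quot_piP; set x' := repr _; set y' := repr _.
have -> : x' * y' - x * y = (x' - x) * y' + x * (y' - y).
  by rewrite mulrBl mulrBr addrA subrK.
by apply: ideal_D; [apply: ideal_Mr|apply: ideal_Ml]; exact: reprB_ideal.
Qed.

Lemma quot_scaleE k x : quot_scale k (quot_pi x) = quot_pi (k *: x).
Proof.
apply/quot_piP; rewrite -scalerBr -[_ - _]mul1r scalerAl.
by apply: ideal_Ml; exact: reprB_ideal.
Qed.

Fact quot_addA : associative quot_add.
Proof.
elim/quot_piW=> x; elim/quot_piW=> y; elim/quot_piW=> z.
by rewrite !quot_addE addrA.
Qed.
Fact quot_addC : commutative quot_add.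
Proof. by elim/quot_piW=> x; elim/quot_piW=> y; rewrite !quot_addE addrC. Qed.
Fact quot_add0 : left_id quot_zero quot_add.
Proof. by elim/quot_piW=> x; rewrite !quot_addE add0r. Qed.
Fact quot_addN : left_inverse quot_zero quot_opp quot_add.
Proof. by elim/quot_piW=> x; rewrite quot_oppE quot_addE addNr. Qed.

HB.instance Definition _ :=
  GRing.isZmodule.Build quot_alg quot_addA quot_addC quot_add0 quot_addN.

Fact quot_mulA : associative quot_mul.
Proof.
elim/quot_piW=> x; elim/quot_piW=> y; elim/quot_piW=> z.
by rewrite !quot_mulE mulrA.
Qed.
Fact quot_mul1l : left_id quot_one quot_mul.
Proof. by elim/quot_piW=> x; rewrite quot_mulE mul1r. Qed.
Fact quot_mul1r : right_id quot_one quot_mul.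
Proof. by elim/quot_piW=> x; rewrite quot_mulE mulr1. Qed.
Fact quot_mulDl : left_distributive quot_mul quot_add.
Proof.
elim/quot_piW=> x; elim/quot_piW=> y; elim/quot_piW=> z.
by rewrite quot_addE !quot_mulE quot_addE mulrDl.
Qed.
Fact quot_mulDr : right_distributive quot_mul quot_add.
Proof.
elim/quot_piW=> x; elim/quot_piW=> y; elim/quot_piW=> z.
by rewrite quot_addE !quot_mulE quot_addE mulrDr.
Qed.

(* The quotient may be the zero ring, so it cannot be declared as an [lalgType],
   which is nontrivial by definition. *)
HB.instance Definition _ := GRing.Zmodule_isPzRing.Build quot_alg
  quot_mulA quot_mul1l quot_mul1r quot_mulDl quot_mulDr.

Fact quot_scaleA a b x :
  quot_scale a (quot_scale b x) = quot_scale (a * b) x.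
Proof. by elim/quot_piW: x => x; rewrite !quot_scaleE scalerA. Qed.
Fact quot_scale1 : left_id 1 quot_scale.
Proof. by elim/quot_piW=> x; rewrite quot_scaleE scale1r. Qed.
Fact quot_scaleDr : right_distributive quot_scale quot_add.
Proof.
move=> a; elim/quot_piW=> x; elim/quot_piW=> y.
by rewrite quot_addE !quot_scaleE quot_addE scalerDr.
Qed.
Fact quot_scaleDl x a b :
  quot_scale (a + b) x = quot_add (quot_scale a x) (quot_scale b x).
Proof. by elim/quot_piW: x => x; rewrite !quot_scaleE quot_addE scalerDl. Qed.

HB.instance Definition _ := GRing.Zmodule_isLmodule.Build K quot_alg
  quot_scaleA quot_scale1 quot_scaleDr quot_scaleDl.

Lemma quot_scalerAl k (x y : quot_alg) : k *: (x * y) = (k *: x) * y.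
Proof.
elim/quot_piW: x => x; elim/quot_piW: y => y.
change (quot_scale k (quot_mul (quot_pi x) (quot_pi y)) =
        quot_mul (quot_scale k (quot_pi x)) (quot_pi y)).
by rewrite quot_mulE !quot_scaleE quot_mulE scalerAl.
Qed.

Fact quot_pi_is_zmod_morphism : zmod_morphism quot_pi.
Proof.
move=> x y; change (quot_pi (x - y) = quot_add (quot_pi x) (quot_opp (quot_pi y))).
by rewrite quot_oppE quot_addE.
Qed.

Fact quot_pi_is_monoid_morphism : monoid_morphism quot_pi.
Proof. by split=> // x y; rewrite -quot_mulE. Qed.

Fact quot_pi_is_scalable : scalable quot_pi.
Proof. by move=> k x; rewrite -quot_scaleE. Qed.

HB.instance Definition _ :=
  GRing.isZmodMorphism.Build A quot_alg quot_pi quot_pi_is_zmod_morphism.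
HB.instance Definition _ :=
  GRing.isMonoidMorphism.Build A quot_alg quot_pi quot_pi_is_monoid_morphism.
HB.instance Definition _ :=
  GRing.isScalable.Build K A quot_alg *:%R quot_pi quot_pi_is_scalable.

End QuotientAlgebra.

Section AskeyWilson.
Variables (K : comNzRingType) (q mu1 mu2 mu3 omega1 omega2 omega3 : K).

(* [{malg K[{fmonom 'I_3}]}] is the algebra of the free monoid on three letters,
   i.e. the free associative unital K-algebra on three generators. *)
Definition free3 := {malg K[{fmonom 'I_3}]}.
HB.instance Definition _ := GRing.Lalgebra.on free3.

Fact free3_scalerAr (k : K) (x y : free3) : k *: (x * y) = x * (k *: y).
Proof.
have kC : malgC k * x = x * malgC k.
  rewrite !malgM_def /malgC fgmulUg fgmulgU.
  by apply: eq_bigr => m _; rewrite mul1m mulm1 mulrC.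
by rewrite -!mul_malgC mulrA kC mulrA.
Qed.
HB.instance Definition _ :=
  GRing.Lalgebra_isAlgebra.Build K free3 free3_scalerAr.

Definition free_X : free3 := << fmu (inord 0 : 'I_3) >>.
Definition free_Y : free3 := << fmu (inord 1 : 'I_3) >>.
Definition free_Z : free3 := << fmu (inord 2 : 'I_3) >>.

Inductive AW_relator : free3 -> Prop :=
| AW_relXY : AW_relator
    (free_X * free_Y - q *: (free_Y * free_X) - (mu3 *: free_Z + omega3%:A))
| AW_relYZ : AW_relator
    (free_Y * free_Z - q *: (free_Z * free_Y) - (mu1 *: free_X + omega1%:A))
| AW_relZX : AW_relator
    (free_Z * free_X - q *: (free_X * free_Z) - (mu2 *: free_Y + omega2%:A)).

Definition AW := quot_alg AW_relator.
HB.instance Definition _ := GRing.PzRing.on AW.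
HB.instance Definition _ := GRing.Lmodule.on AW.

Lemma AW_scalerAl k (x y : AW) : k *: (x * y) = k *: x * y.
Proof. exact: quot_scalerAl. Qed.

Lemma AW_scalerAr k (x y : AW) : k *: (x * y) = x * (k *: y).
Proof.
elim/quot_piW: x => x; elim/quot_piW: y => y.
have pM u v : quot_pi AW_relator (u * v) = quot_pi _ u * quot_pi _ v.
  exact: (quot_pi_is_monoid_morphism AW_relator).2.
have pZ u : quot_pi AW_relator (k *: u) = k *: quot_pi _ u.
  exact: quot_pi_is_scalable.
by rewrite -pM -!pZ -pM free3_scalerAr.
Qed.

Definition AW_X : AW := quot_pi AW_relator free_X.
Definition AW_Y : AW := quot_pi AW_relator free_Y.
Definition AW_Z : AW := quot_pi AW_relator free_Z.

Lemma AW_relations :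
  [/\ AW_X * AW_Y - q *: (AW_Y * AW_X) = mu3 *: AW_Z + omega3 *: (1 : AW),
      AW_Y * AW_Z - q *: (AW_Z * AW_Y) = mu1 *: AW_X + omega1 *: (1 : AW)
    & AW_Z * AW_X - q *: (AW_X * AW_Z) = mu2 *: AW_Y + omega2 *: (1 : AW)].
Proof.
pose p := quot_pi AW_relator.
have rel U V W m o :
    AW_relator (U * V - q *: (V * U) - (m *: W + o%:A)) ->
  p U * p V - q *: (p V * p U) = m *: p W + o *: p 1.
  move/ideal_in/quot_piP; rewrite -/p => e.
  have pB x y : p (x - y) = p x - p y by exact: quot_pi_is_zmod_morphism.
  have pZ k x : p (k *: x) = k *: p x by exact: quot_pi_is_scalable.
  have pM x y : p (x * y) = p x * p y.
    exact: (quot_pi_is_monoid_morphism AW_relator).2.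
  have pD x y : p (x + y) = p x + p y by exact: (raddfD p).
  by rewrite -!pM -!pZ -pB -pD.
have <- : p 1 = 1 by exact: (quot_pi_is_monoid_morphism AW_relator).1.
by split; [exact: rel AW_relXY|exact: rel AW_relYZ|exact: rel AW_relZX].
Qed.

End AskeyWilson.

Section PolyEndo.
Variable R : realType.

Definition poly_endo := {linear {poly R} -> {poly R}}.
HB.instance Definition _ := gen_eqMixin poly_endo.
HB.instance Definition _ := gen_choiceMixin poly_endo.

Implicit Types S T U : poly_endo.

Lemma poly_endoP S T : (forall f, S f = T f) <-> S = T.
Proof.
split=> [|->//]; case: S T => [S [[SD] [SZ]]] [T [[TD] [TZ]]] /= ST.
have {}ST : S = T by apply: funext.
case: T / ST TD TZ => TD TZ.
by rewrite (Prop_irrelevance SD TD) (Prop_irrelevance SZ TZ).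
Qed.

Definition endo_zero : poly_endo := \0.
Definition endo_opp S : poly_endo := \- S.
Definition endo_add S T : poly_endo := S \+ T.
Definition endo_one : poly_endo := idfun.
Definition endo_mul S T : poly_endo := S \o T.
Definition endo_scale (k : R) S : poly_endo := k \*: S.

Fact endo_addA : associative endo_add.
Proof. by move=> S T U; apply/poly_endoP => f; exact: addrA. Qed.
Fact endo_addC : commutative endo_add.
Proof. by move=> S T; apply/poly_endoP => f; exact: addrC. Qed.
Fact endo_add0 : left_id endo_zero endo_add.
Proof. by move=> S; apply/poly_endoP => f; exact: add0r. Qed.
Fact endo_addN : left_inverse endo_zero endo_opp endo_add.
Proof. by move=> S; apply/poly_endoP => f; exact: addNr. Qed.

HB.instance Definition _ :=
  GRing.isZmodule.Build poly_endo endo_addA endo_addC endo_add0 endo_addN.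

Fact endo_mulA : associative endo_mul.
Proof. by move=> S T U; apply/poly_endoP. Qed.
Fact endo_mul1l : left_id endo_one endo_mul.
Proof. by move=> S; apply/poly_endoP. Qed.
Fact endo_mul1r : right_id endo_one endo_mul.
Proof. by move=> S; apply/poly_endoP. Qed.
Fact endo_mulDl : left_distributive endo_mul endo_add.
Proof. by move=> S T U; apply/poly_endoP. Qed.
Fact endo_mulDr : right_distributive endo_mul endo_add.
Proof. by move=> S T U; apply/poly_endoP => f; exact: raddfD. Qed.
Fact endo_1neq0 : endo_one != endo_zero.
Proof. by apply/eqP => /poly_endoP /(_ 1) /eqP; rewrite oner_eq0. Qed.

HB.instance Definition _ := GRing.Zmodule_isNzRing.Build poly_endo
  endo_mulA endo_mul1l endo_mul1r endo_mulDl endo_mulDr endo_1neq0.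

Fact endo_scaleA a b S : endo_scale a (endo_scale b S) = endo_scale (a * b) S.
Proof. by apply/poly_endoP => f; exact: scalerA. Qed.
Fact endo_scale1 : left_id 1 endo_scale.
Proof. by move=> S; apply/poly_endoP => f; exact: scale1r. Qed.
Fact endo_scaleDr : right_distributive endo_scale +%R.
Proof. by move=> a S T; apply/poly_endoP => f; exact: scalerDr. Qed.
Fact endo_scaleDl S : {morph endo_scale^~ S : a b / a + b}.
Proof. by move=> a b; apply/poly_endoP => f; exact: scalerDl. Qed.

HB.instance Definition _ := GRing.Zmodule_isLmodule.Build R poly_endo
  endo_scaleA endo_scale1 endo_scaleDr endo_scaleDl.

Fact endo_scaleAl k S T : k *: (S * T) = k *: S * T.
Proof. by apply/poly_endoP. Qed.
HB.instance Definition _ :=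
  GRing.Lmodule_isLalgebra.Build R poly_endo endo_scaleAl.

Fact endo_scaleAr k S T : k *: (S * T) = S * (k *: T).
Proof. by apply/poly_endoP => f; rewrite [RHS]linearZ. Qed.
HB.instance Definition _ :=
  GRing.Lalgebra_isAlgebra.Build R poly_endo endo_scaleAr.

Lemma endoE :
  [/\ forall S T f, (S + T) f = S f + T f,
      forall S f, (- S) f = - S f,
      forall S T f, (S * T) f = S (T f),
      forall k S f, (k *: S) f = k *: S f
    & forall f, (1 : poly_endo) f = f].
Proof. by []. Qed.

End PolyEndo.

Section Operators.
Variables (R : realType) (alpha beta c : R).
Implicit Types f : {poly R}.

Definition reflection f := f \Po (- 'X).

Lemma horner_reflection f x : (reflection f).[x] = f.[- x].
Proof. by rewrite horner_comp hornerN hornerX. Qed.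

(* x^2 L_0 f(x) and x (Z f)(x) as polynomials.  Both are exactly divisible by
   x^2, resp. x ([L0_divides], [Z_divides]), so that the Euclidean quotients
   below are the operators given by the rational formulas
   ([L0_fun_horner], [Z_fun_horner]). *)
Definition L0_num f : {poly R} :=
  ((alpha + beta + 1) *: 'X^2 + (c * alpha - beta) *: 'X + c%:P)
    * (reflection f - f)
  - 2 *: ('X * (('X - 1) * ('X + c%:P)) * reflection f^`()).
Definition Z_num f : {poly R} :=
  - 2 *: (c *: f + ('X - 1) * ('X + c%:P) * reflection f).

Lemma reflection_is_linear : linear reflection.
Proof. by move=> k f g; rewrite /reflection comp_polyD comp_polyZ. Qed.

Lemma reflectionC a : reflection a%:P = a%:P.
Proof. exact: comp_polyC. Qed.
Lemma reflectionD f g : reflection (f + g) = reflection f + reflection g.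
Proof. exact: comp_polyD. Qed.
Lemma reflectionM f g : reflection (f * g) = reflection f * reflection g.
Proof. exact: comp_polyM. Qed.
Lemma reflectionX : reflection 'X = - 'X.
Proof. exact: comp_polyX. Qed.

Lemma L0_num_is_linear : linear L0_num.
Proof.
move=> k f g; rewrite /L0_num derivD derivZ !reflection_is_linear.
rewrite -!mul_polyC; ring.
Qed.

Lemma Z_num_is_linear : linear Z_num.
Proof.
move=> k f g; rewrite /Z_num !reflection_is_linear -!mul_polyC; ring.
Qed.

Lemma Z_divides f : 'X %| Z_num f.
Proof.
rewrite -['X]subr0 -polyC0 dvdp_XsubCl /root /Z_num !hornerE horner_reflection.
apply/eqP; rewrite oppr0; ring.
Qed.

Lemma L0_divides f : 'X^2 %| L0_num f.
Proof.
have L0_0 a : L0_num a%:P = 0.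
  by rewrite /L0_num derivC !reflectionC subrr !mulr0 scaler0 subr0.
elim/poly_ind: f => [|f a _]; first by rewrite -polyC0 L0_0 dvdp0.
elim/poly_ind: f => [|f b _]; first by rewrite mul0r add0r L0_0 dvdp0.
rewrite /L0_num !derivE !reflectionD !reflectionM !reflectionD !reflectionM !reflectionC !reflectionX.
set g := reflection f; set g' := reflection f^`().
apply/dvdpP; exists
  (((alpha + beta + 1) *: 'X^2 + (c * alpha - beta) *: 'X + c%:P) * (g - f)
   - 2 *: (('X - 1) * ('X + c%:P) * (g' * 'X - 2 *: g))
   - (2 * b) *: ((alpha + beta + 1) *: 'X + (c * alpha - beta)%:P
                 + 'X + (c - 1)%:P)).
rewrite -!mul_polyC !(polyCM, polyCD, polyCB, polyC1); ring.
Qed.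

Definition L0_fun f := L0_num f %/ 'X^2.
Definition Z_fun f := Z_num f %/ 'X.
Definition Y_fun f := 'X * f.

Lemma L0_fun_is_linear : linear L0_fun.
Proof. by move=> k f g; rewrite /L0_fun L0_num_is_linear divpD divpZl. Qed.
Lemma Z_fun_is_linear : linear Z_fun.
Proof. by move=> k f g; rewrite /Z_fun Z_num_is_linear divpD divpZl. Qed.
Lemma Y_fun_is_linear : linear Y_fun.
Proof. by move=> k f g; rewrite /Y_fun mulrDr -scalerAr. Qed.

HB.instance Definition _ :=
  GRing.isLinear.Build R {poly R} {poly R} *:%R L0_fun L0_fun_is_linear.
HB.instance Definition _ :=
  GRing.isLinear.Build R {poly R} {poly R} *:%R Z_fun Z_fun_is_linear.
HB.instance Definition _ :=
  GRing.isLinear.Build R {poly R} {poly R} *:%R Y_fun Y_fun_is_linear.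

Lemma L0_fun_horner f x : x != 0 ->
  (L0_fun f).[x] =
    ((alpha + beta + 1) * x ^+ 2 + (c * alpha - beta) * x + c) / x ^+ 2
      * (f.[- x] - f.[x])
    - 2 * (x - 1) * (x + c) / x * f^`().[- x].
Proof.
move=> x0.
have e : (L0_fun f).[x] * x ^+ 2 =
    ((alpha + beta + 1) * x ^+ 2 + (c * alpha - beta) * x + c)
      * (f.[- x] - f.[x])
    - 2 * (x * ((x - 1) * (x + c)) * f^`().[- x]).
  rewrite -hornerXn -hornerM (divpK (L0_divides f)) /L0_num.
  by rewrite !(hornerD, hornerN, hornerZ, hornerM, hornerC, hornerX, hornerXn,
    horner_reflection).
by apply: (mulIf (expf_neq0 2 x0)); rewrite e; field.
Qed.

Lemma Z_fun_horner f x : x != 0 ->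
  (Z_fun f).[x] = - (2 / x) * (c * f.[x] + (x - 1) * (x + c) * f.[- x]).
Proof.
move=> x0.
have e : (Z_fun f).[x] * x =
    - 2 * (c * f.[x] + (x - 1) * (x + c) * f.[- x]).
  rewrite -{2}[x]hornerX -hornerM (divpK (Z_divides f)) /Z_num.
  by rewrite !(hornerD, hornerN, hornerZ, hornerM, hornerC, hornerX,
    horner_reflection).
by apply: (mulIf x0); rewrite e; field.
Qed.

Definition L0_op : poly_endo R := L0_fun.
Definition X_op : poly_endo R := L0_op + (alpha + beta + 1)%:A.
Definition Y_op : poly_endo R := Y_fun.
Definition Z_op : poly_endo R := Z_fun.

End Operators.

(* Main.v *)
From HB Require Import structures.
Require Import Defs.
From mathcomp Require Import all_boot all_order all_algebra.
From mathcomp Require Import generic_quotient reals ring.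
From mathcomp.multinomials Require Import monalg.

(** The relations between the operators are checked pointwise
    ([operator_relations]).  At a nonzero point [t], the values of [X f], [Y f]
    and [Z f] are rational expressions in [t], [f(t)], [f(-t)] and [f'(-t)], and
    the reflection only exchanges [t] and [-t]; after composing two operators,
    each relation is an identity of rational functions in [t] and in the values
    at [t] and [-t] of [f] and [f'], treated as independent.  Only first
    derivatives of [f], [Y f] and [Z f] occur, because [L_0] is of first order and
    no relation composes [X] with itself.  As a polynomial is determined by its values off zero,
    this gives the three relations and the value of the Casimir element.

    The representation [rho] comes from the universal property of a presented
    algebra ([AW_lift]): words in three letters are evaluated on [X], [Y], [Z],
    and this evaluation kills the relators, hence the ideal that they generate,
    and so factors through the quotient.  The value of [rho Q] is then that of
    the same expression in the operators.

    Centrality is a computation in an arbitrary ring ([casimir_comm]).  It rests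
    on the identity [[u^2, v] = [u, {u, v}]], where [{u, v} = u v + v u].  Each
    anticommutator of generators is affine in the generators, so
    [[z^2, x] = [z, 4 y]] and [[y^2, x] = [y, z]], which cancel in
    [[z^2 + 4 y^2, x]], while [{y, z}] is a scalar, so that [z^2] commutes with
    [y], and [y^2] with [z]. *)

Import GRing.Theory.
Local Open Scope ring_scope.

(** * Factoring a morphism through a quotient algebra *)

Section QuotientLift.
Variables (K : comNzRingType) (A : lalgType K) (S : A -> Prop).
Variables (B : lalgType K) (phi : {lrmorphism A -> B}).
Hypothesis phiS : forall a, S a -> phi a = 0.

Lemma ideal_gen_eq0 a : ideal_gen S a -> phi a = 0.
Proof.
elim=> [b /phiS //||b d _ b0 _ d0|b d _ d0|b d _ d0].
- exact: rmorph0.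
- by rewrite rmorphD /= b0 d0 addr0.
- by rewrite rmorphM /= d0 mulr0.
- by rewrite rmorphM /= d0 mul0r.
Qed.

(** The vanishing proof is an argument so that the morphism structures declared
    below can be inferred from the term alone. *)
Definition quot_lift of (forall a, S a -> phi a = 0) :=
  fun u : quot_alg S => phi (repr u).

Lemma quot_liftE a : quot_lift phiS (quot_pi S a) = phi a.
Proof.
apply/eqP; rewrite -subr_eq0 -rmorphB; apply/eqP/ideal_gen_eq0.
exact: reprB_ideal.
Qed.

Fact quot_lift_is_zmod_morphism : zmod_morphism (quot_lift phiS).
Proof.
elim/quot_piW=> a; elim/quot_piW=> b.
by rewrite -(raddfB (quot_pi S)) !quot_liftE rmorphB.
Qed.

Fact quot_lift_is_monoid_morphism : monoid_morphism (quot_lift phiS).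
Proof.
split; first by rewrite -(rmorph1 (quot_pi S)) quot_liftE rmorph1.
elim/quot_piW=> a; elim/quot_piW=> b.
by rewrite -(rmorphM (quot_pi S)) !quot_liftE rmorphM.
Qed.

HB.instance Definition _ := GRing.isZmodMorphism.Build (quot_alg S) B
  (quot_lift phiS) quot_lift_is_zmod_morphism.
HB.instance Definition _ := GRing.isMonoidMorphism.Build (quot_alg S) B
  (quot_lift phiS) quot_lift_is_monoid_morphism.

Lemma quot_lift_scalable : scalable (quot_lift phiS).
Proof.
move=> k; elim/quot_piW=> a.
by rewrite -(quot_pi_is_scalable S k a) !quot_liftE linearZ.
Qed.

End QuotientLift.

(** * Evaluation of noncommutative polynomials *)

Section FreeEval.
Variables (K : comNzRingType) (E : algType K) (v : 'I_3 -> E).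

Definition word_eval (m : {fmonom 'I_3}) : E := \prod_(i <- (m : seq _)) v i.

Fact word_eval_is_mmorphism : @mmorphism {fmonom 'I_3} E word_eval.
Proof.
split=> [m n|]; rewrite /word_eval; first by rewrite fmM big_cat.
by rewrite fm1 big_nil.
Qed.
HB.instance Definition _ :=
  isMultiplicative.Build {fmonom 'I_3} E word_eval word_eval_is_mmorphism.

Definition free_eval : free3 K -> E := mmap (in_alg E) word_eval.

Fact free_eval_is_zmod_morphism : zmod_morphism free_eval.
Proof. exact: mmapB. Qed.

(** Multiplicativity into a noncommutative target holds because the images of the
    coefficients are scalar multiples of 1, hence central. *)
Fact free_eval_is_monoid_morphism : monoid_morphism free_eval.
Proof.
suff [eM e1] : MMorphism.axiom free_eval by split.
apply: commr_mmap_is_multiplicative => a m m'.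
by rewrite /GRing.comm mulr_algl mulr_algr.
Qed.

HB.instance Definition _ := GRing.isZmodMorphism.Build (free3 K) E
  free_eval free_eval_is_zmod_morphism.
HB.instance Definition _ := GRing.isMonoidMorphism.Build (free3 K) E
  free_eval free_eval_is_monoid_morphism.

Fact free_eval_is_scalable : scalable free_eval.
Proof. by move=> k a; rewrite /free_eval mmapZ mulr_algl. Qed.

HB.instance Definition _ := GRing.isScalable.Build K (free3 K) E *:%R
  free_eval free_eval_is_scalable.

Lemma free_evalU i : free_eval << fmu i >> = v i.
Proof.
by rewrite /free_eval mmapU /= scale1r mul1r /word_eval fmU big_seq1.
Qed.

End FreeEval.

(** * The Casimir element *)

Section CentralElement.
Variable B : pzRingType.
Implicit Types u v w x y z : B.

(** This trades the commutator with a square for the anticommutator, which is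
    what the relations for [q = -1] prescribe. *)
Lemma sqr_commutator u v :
  u ^+ 2 * v - v * u ^+ 2 = u * (u * v + v * u) - (u * v + v * u) * u.
Proof. by rewrite !expr2 mulrDr mulrDl !mulrA opprD addrA addrK. Qed.

(** By [sqr_commutator], [z^2] contributes [4 (z y - y z)] to the commutator with
    [x], and [4 y^2] contributes [4 (y z - z y)].  The relations are written
    in the language of rings, with [w1], [w2], [w3] for the scalars, because the
    quotient algebra may be zero and is therefore only a ring and a module. *)
Lemma casimir_comm x y z w1 w2 w3 :
    (forall u, w1 * u = u * w1) -> (forall u, w2 * u = u * w2) ->
    (forall u, w3 * u = u * w3) ->
    x * y + y * x = z + w3 -> y * z + z * y = w1 ->
    z * x + x * z = y *+ 4 + w2 ->
  let Q := z ^+ 2 + y ^+ 2 *+ 4 in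
  [/\ Q * x = x * Q, Q * y = y * Q & Q * z = z * Q].
Proof.
move=> w1C w2C w3C xy yz zx Q.
have anti u v : u * v + v * u = w1 -> u ^+ 2 * v = v * u ^+ 2.
  by move=> uv; apply/eqP; rewrite -subr_eq0 sqr_commutator uv w1C subrr.
have QE u : Q * u - u * Q =
    (z ^+ 2 * u - u * z ^+ 2) + (y ^+ 2 * u - u * y ^+ 2) *+ 4.
  by rewrite /Q mulrDl mulrDr mulrnAl mulrnAr opprD addrACA mulrnBl.
have addrDK a b d : (a + d) - (b + d) = a - b :> B.
  by rewrite opprD addrACA subrr addr0.
split; apply/eqP; rewrite -subr_eq0 QE.
- rewrite !sqr_commutator zx [y * x + _]addrC xy.
  (* Explicit arguments: [y *+ 4] is convertible to a sum and would be split. *)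
  rewrite (mulrDr z (y *+ 4)) (mulrDl (y *+ 4)) (mulrDr y z) (mulrDl z) w2C w3C.
  rewrite !addrDK mulrnAr mulrnAl -mulrnBl -mulrnDl -[y * z - _]opprB subrr.
  by rewrite mul0rn.
- by rewrite (anti z y) 1?addrC // !expr2 !mulrA !subrr mul0rn addr0.
- by rewrite (anti y z) // !expr2 !mulrA !subrr mul0rn addr0.
Qed.

End CentralElement.

(** * The presented algebra *)

(** The three relators have this common form. *)
Lemma lrmorph_relator (K : comNzRingType) (A E : lalgType K)
    (phi : {lrmorphism A -> E}) (q m o : K) (U V W : A) :
  phi (U * V - q *: (V * U) - (m *: W + o%:A)) =
  phi U * phi V - q *: (phi V * phi U) - (m *: phi W + o%:A).
Proof.
have phiB a b : phi (a - b) = phi a - phi b by exact: rmorphB.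
have phiD a b : phi (a + b) = phi a + phi b by exact: rmorphD.
have phiM a b : phi (a * b) = phi a * phi b by exact: rmorphM.
have phiZ k a : phi (k *: a) = k *: phi a by exact: linearZ.
have phi1 : phi 1 = 1 by exact: rmorph1.
by rewrite !phiB phiD !phiZ !phiM phi1.
Qed.

Section AskeyWilson.
Variables (K : comNzRingType) (q mu1 mu2 mu3 omega1 omega2 omega3 : K).

(** Universal property of the Askey-Wilson algebra: its representations are the
    triples that satisfy the relations. *)
Lemma AW_lift (E : algType K) (X Y Z : E) :
    X * Y - q *: (Y * X) = mu3 *: Z + omega3%:A ->
    Y * Z - q *: (Z * Y) = mu1 *: X + omega1%:A ->
    Z * X - q *: (X * Z) = mu2 *: Y + omega2%:A ->
  exists rho : {rmorphism AW q mu1 mu2 mu3 omega1 omega2 omega3 -> E},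
    [/\ scalable rho, rho (AW_X q mu1 mu2 mu3 omega1 omega2 omega3) = X,
        rho (AW_Y q mu1 mu2 mu3 omega1 omega2 omega3) = Y
      & rho (AW_Z q mu1 mu2 mu3 omega1 omega2 omega3) = Z].
Proof.
move=> XY YZ ZX.
pose v := nth (0 : E) [:: X; Y; Z] \o @nat_of_ord 3.
pose phi : {lrmorphism free3 K -> E} := free_eval _ _ v.
have [phiX phiY phiZ] :
    [/\ phi (free_X K) = X, phi (free_Y K) = Y & phi (free_Z K) = Z].
  by split; rewrite [LHS]free_evalU /v /= inordK.
have phiS a : AW_relator q mu1 mu2 mu3 omega1 omega2 omega3 a -> phi a = 0.
  case; (etransitivity; first exact: (lrmorph_relator K (free3 K) E phi)).
  - by rewrite phiX phiY phiZ XY subrr.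
  - by rewrite phiX phiY phiZ YZ subrr.
  - by rewrite phiX phiY phiZ ZX subrr.
pose rho := quot_lift _ _ _ _ phi phiS.
have rhoE a : rho (quot_pi _ a) = phi a by exact: quot_liftE.
exists rho; split; first exact: quot_lift_scalable.
- by rewrite -phiX; exact: rhoE.
- by rewrite -phiY; exact: rhoE.
- by rewrite -phiZ; exact: rhoE.
Qed.

Lemma AW_casimir_central :
  let x := AW_X (-1) 0 4 1 omega1 omega2 omega3 in
  let y := AW_Y (-1) 0 4 1 omega1 omega2 omega3 in
  let z := AW_Z (-1) 0 4 1 omega1 omega2 omega3 in
  let Q := z ^+ 2 + 4 *: y ^+ 2 in
  [/\ Q * x = x * Q, Q * y = y * Q & Q * z = z * Q].
Proof.
move=> x y z Q.
have [xy yz zx] := AW_relations (-1) 0 4 1 omega1 omega2 omega3.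
pose A := AW (-1) 0 4 1 omega1 omega2 omega3.
have wC k (u : A) : (k *: (1 : A)) * u = u * (k *: (1 : A)).
  by rewrite -AW_scalerAl -AW_scalerAr mul1r mulr1.
have antiE (u v w : A) : u * v - (-1) *: (v * u) = w -> u * v + v * u = w.
  by rewrite (scaleN1r (v * u)) opprK.
have QE : Q = z ^+ 2 + y ^+ 2 *+ 4 by rewrite /Q (scaler_nat 4 (y ^+ 2)).
rewrite QE.
pose w (k : K) : A := k *: (1 : A).
apply: (casimir_comm A x y z (w omega1) (w omega2) (w omega3));
  [exact: wC|exact: wC|exact: wC| | |].
- apply: etrans (antiE _ _ _ xy) _; congr (_ + _); exact: scale1r.
- apply: etrans (antiE _ _ _ yz) _; rewrite (scale0r x) add0r; exact: erefl.
- apply: etrans (antiE _ _ _ zx) _; congr (_ + _); exact: scaler_nat.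
Qed.

End AskeyWilson.

(** * The operators on polynomials *)

Section Realization.
Variable R : realType.

(** The difference vanishes at the infinitely many points [1, 2, 3, ...]. *)
Lemma poly_horner_neq0 (p r : {poly R}) :
  (forall x, x != 0 -> p.[x] = r.[x]) -> p = r.
Proof.
move=> pr; apply/eqP; rewrite -subr_eq0; apply/eqP.
pose rs : seq R := [seq i.+1%:R | i <- iota 0 (size (p - r))].
apply: (@roots_geq_poly_eq0 _ _ rs); last by rewrite size_map size_iota.
  apply/allP => _ /mapP[i _ ->]; rewrite rootE hornerD hornerN pr ?subrr //.
  by rewrite Num.Theory.pnatr_eq0.
rewrite map_inj_uniq ?iota_uniq // => i j /eqP.
by rewrite Num.Theory.eqr_nat => /eqP[].
Qed.

Variables (alpha beta c : R).
Local Notation X := (X_op alpha beta c).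
Local Notation Y := (Y_op R).
Local Notation Z := (Z_op c).

Lemma X_op_horner f x : x != 0 ->
  (X f).[x] =
    ((alpha + beta + 1) * x ^+ 2 + (c * alpha - beta) * x + c) / x ^+ 2
      * (f.[- x] - f.[x])
    - 2 * (x - 1) * (x + c) / x * f^`().[- x] + (alpha + beta + 1) * f.[x].
Proof.
move=> x0; rewrite -(@L0_fun_horner _ _ _ _ f x x0).
by rewrite /= hornerD hornerZ.
Qed.

Lemma Y_op_horner f x : (Y f).[x] = x * f.[x].
Proof. by rewrite /= /Y_fun hornerM hornerX. Qed.

Lemma Y_op_deriv_horner f x : (Y f)^`().[x] = f.[x] + x * f^`().[x].
Proof. by rewrite /= /Y_fun derivM derivX mul1r hornerD hornerM hornerX. Qed.

Lemma Z_op_horner f x : x != 0 ->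
  (Z f).[x] = - (2 / x) * (c * f.[x] + (x - 1) * (x + c) * f.[- x]).
Proof. exact: Z_fun_horner. Qed.

(** Differentiating [(Z f) * 'X = Z_num f] gives the derivative of [Z f] without
    differentiating the quotient itself; the value of [Z f] stays on the right. *)
Lemma Z_op_deriv_horner f x : x != 0 ->
  (Z f)^`().[x] =
    - (2 / x) * (c * f^`().[x] + (2 * x + c - 1) * f.[- x]
                 - (x - 1) * (x + c) * f^`().[- x]) - (Z f).[x] / x.
Proof.
move=> x0; have := congr1 (fun p => p^`().[x]) (divpK (Z_divides c f)).
rewrite derivM derivX mulr1 hornerD hornerM hornerX -/(Z_fun c f).
rewrite /Z_num /reflection !(derivE, deriv_comp, hornerE) !horner_comp !hornerE.
rewrite /= -[Z_fun c f]/(Z f) => e.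
by apply: (mulIf x0); rewrite -[LHS](addrK (Z f).[x]) e; field.
Qed.

Lemma operator_relations :
  [/\ X * Y + Y * X = Z + (2 * (beta - alpha * c))%:A,
      Y * Z + Z * Y = (- 4 * c)%:A,
      Z * X + X * Z = 4 *: Y + (4 * (alpha - beta * c))%:A
    & Z ^+ 2 + 4 *: Y ^+ 2 = (4 * (c ^+ 2 + 1))%:A].
Proof.
(* The operators are generalized: since [X_op] is a sum, rewriting with the
   evaluation of sums of operators would otherwise unfold it. *)
move: X Y Z X_op_horner Y_op_horner Y_op_deriv_horner Z_op_horner
  Z_op_deriv_horner => X Y Z XE YE dYE ZE dZE.
case: (endoE R) => addE _ mulE scaleE oneE.
have pointwise (S T : poly_endo R) :
    (forall f (x : R), x != 0 -> - x != 0 -> (S f).[x] = (T f).[x]) -> S = T.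
  move=> ST; apply/poly_endoP => f; apply: poly_horner_neq0 => x x0.
  by rewrite ST // oppr_eq0.
pose opE := (addE, mulE, scaleE, oneE, hornerD, hornerZ).
rewrite !expr2; split; apply: pointwise => f x x0 Nx0; rewrite ?opE.
- rewrite XE // !YE dYE XE // ZE //.
  move: f.[x] f.[- x] f^`().[- x] => a b b1; field; exact: x0.
- rewrite YE ZE // ZE // !YE.
  move: f.[x] f.[- x] => a b; field; exact: x0.
- rewrite [(X (Z f)).[x]]XE // dZE // !ZE // !XE // YE !opprK.
  move: f.[x] f.[- x] f^`().[x] f^`().[- x] => a b a1 b1; field; exact: x0.
- rewrite !YE !ZE // !opprK.
  move: f.[x] f.[- x] => a b; field; exact: x0.
Qed.

End Realization.

Theorem mainTheorem6 (R : realType) (alpha beta c : R) :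
  let omega1 := - 4 * c in
  let omega2 := 4 * (alpha - beta * c) in
  let omega3 := 2 * (beta - alpha * c) in
  let X := X_op alpha beta c in
  let Y := Y_op R in
  let Z := Z_op c in
  let A := AW (-1) 0 4 1 omega1 omega2 omega3 in
  let x : A := AW_X (-1) 0 4 1 omega1 omega2 omega3 in
  let y : A := AW_Y (-1) 0 4 1 omega1 omega2 omega3 in
  let z : A := AW_Z (-1) 0 4 1 omega1 omega2 omega3 in
  let Q : A := z ^+ 2 + 4 *: y ^+ 2 in
  [/\ [/\ X * Y + Y * X = Z + omega3%:A,
          Y * Z + Z * Y = omega1%:A
        & Z * X + X * Z = 4 *: Y + omega2%:A],
      exists rho : {rmorphism A -> poly_endo R},
        [/\ scalable rho, rho x = X, rho y = Y, rho z = Z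
          & rho Q = (4 * (c ^+ 2 + 1))%:A],
      [/\ Q * x = x * Q, Q * y = y * Q & Q * z = z * Q]
    & Z ^+ 2 + 4 *: Y ^+ 2 = (4 * (c ^+ 2 + 1))%:A].
Proof.
move=> w1 w2 w3 X Y Z A x y z Q.
have [XY YZ ZX QZ] := @operator_relations R alpha beta c.
split; [by split| |exact: AW_casimir_central|exact: QZ].
have [|||rho [rhoZ rX rY rZ]] :=
    @AW_lift R (-1) 0 4 1 w1 w2 w3 (poly_endo R) X Y Z.
- by rewrite scaleN1r opprK scale1r; exact: XY.
- by rewrite scaleN1r opprK scale0r add0r; exact: YZ.
- by rewrite scaleN1r opprK; exact: ZX.
exists rho; split; [exact: rhoZ|exact: rX|exact: rY|exact: rZ|].
apply: etrans (rmorphD rho _ _) _; apply: etrans QZ; congr (_ + _).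
- by apply: etrans (rmorphXn rho 2 z) _; rewrite rZ.
- apply: etrans (rhoZ 4 (y ^+ 2)) _; congr (_ *: _).
  by apply: etrans (rmorphXn rho 2 y) _; rewrite rY.
Qed.
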